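(* Let $n\ge2$, let $\pi\in S_n$ with $\pi_1=n$ or $\pi_1=n-1$, and let $k$ be an integer. Put $\pi'=T^{k}(\pi)$, $\pi''=T^{-k}(\pi)$, $\pi'''=T^{-k+2}(\pi)$. Then: (1) $\pi'_i=\pi''_i$ for $1\le i\le \pi'_1$, and $\pi'_{i}=\pi''_{n+\pi'_1+1-i}$ for $\pi'_1+1\le i\le n$; that is, $\pi'$ and $\pi''$ have the same first $\pi'_1$ entries, while the last $n-\pi'_1$ entries of $\pi'$ are those of $\pi''$ in reverse order. (2) $\pi'_i=\pi'''_{n-\pi'_n+1-i}$ for $1\le i\le n-\pi'_n$, and $\pi'_i=\pi'''_i$ for $n-\pi'_n+1\le i\le n$; that is, $\pi'$ and $\pi'''$ have the same last $\pi'_n$ entries, while the first $n-\pi'_n$ entries of $\pi'$ are those of $\pi'''$ in reverse order.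
   Context: Permutations are in one-line notation $\pi=\pi_1\cdots\pi_n$. The topdrop map $T:S_n\to S_n$ is $T(\pi_1\cdots\pi_n)=\pi_{\pi_1+1}\cdots\pi_n\,\pi_{\pi_1}\pi_{\pi_1-1}\cdots\pi_1$ (first $\pi_1$ entries removed, reversed, appended at the end); it is a bijection, and $T^{k}$ for an integer $k$ denotes the $|k|$-fold iterate of $T$ (if $k\ge0$) or of $T^{-1}$ (if $k<0$). *)

(* Defs.v *)
From mathcomp Require Import all_boot all_order all_algebra all_fingroup.
From mathcomp Require Import zify.

Set Implicit Arguments.
Unset Strict Implicit.
Unset Printing Implicit Defensive.

(* A permutation of {1, ..., n} is an element of 'S_n, whose indices and values
   run over 'I_n = {0, ..., n-1}; [oneline] and [entry] shift both by one. *)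
Definition oneline (n : nat) (p : 'S_n) : seq nat :=
  [seq (p i).+1 | i <- enum 'I_n].

(* [entry p i] is the entry p_i of the one-line notation; it is meaningful only for 1 <= i <= n. *)
Definition entry (n : nat) (p : 'S_n) (i : nat) : nat :=
  nth 0 (oneline p) i.-1.

Lemma size_oneline n (p : 'S_n) : size (oneline p) = n.
Proof. by rewrite size_map size_enum_ord. Qed.

Lemma entryE n (p : 'S_n) (i : 'I_n) : entry p i.+1 = (p i).+1.
Proof.
by rewrite /entry /= (nth_map i) ?size_enum_ord // nth_ord_enum.
Qed.

(* The (0-based) position from which the entry at position i is taken when the
   first c entries are removed, reversed and appended at the end: i + c if this
   is less than n, and n - 1 - i otherwise. *)
Definition drop_pos (n c : nat) (i : 'I_n) : 'I_n := insubd (rev_ord i) (i + c).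

Lemma val_drop_pos n c (i : 'I_n) :
  drop_pos c i = (if i + c < n then i + c else n - i.+1) :> nat.
Proof. by rewrite /drop_pos val_insubd. Qed.

Lemma drop_pos_inj n c : injective (@drop_pos n c).
Proof.
move=> i j /(congr1 val) /=; rewrite !val_drop_pos => eq_ij; apply: val_inj => /=.
move: eq_ij (ltn_ord i) (ltn_ord j); case: ifPn; case: ifPn; lia.
Qed.

Definition topdrop (n : nat) (p : 'S_n) : 'S_n :=
  (perm (@drop_pos_inj n (entry p 1)) * p)%g.

Lemma topdropE n (p : 'S_n) i : topdrop p i = p (drop_pos (entry p 1) i).
Proof. by rewrite permM permE. Qed.

Lemma oneline_topdrop n (p : 'S_n) :
  let c := entry p 1 in
  oneline (topdrop p) = drop c (oneline p) ++ rev (take c (oneline p)).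
Proof.
set c := entry p 1 => /=.
have le_cn : c <= n.
  case: n p @c => [|n] p c; last by rewrite /c (entryE p ord0).
  by rewrite /c /entry nth_default // size_oneline.
apply: (@eq_from_nth _ 0).
  by rewrite size_cat size_rev -size_cat size_cat size_drop size_take_min !size_oneline; lia.
move=> i; rewrite size_oneline => lt_in.
have /= := entryE (topdrop p) (Ordinal lt_in); rewrite /entry /= => ->.
rewrite topdropE -entryE /entry [_.-1]/= val_drop_pos /= -/c.
rewrite nth_cat size_drop size_oneline ltn_subRL addnC.
rewrite -[nth 0 (oneline p) 0]/c;
case: ifPn => [_|ge_in]; first by rewrite nth_drop.
have szt : size (take c (oneline p)) = c by rewrite size_takel // size_oneline.
rewrite nth_rev szt; last by lia.
rewrite nth_take; last by lia.
by congr nth; lia.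
Qed.

Lemma topdrop_inj n : injective (@topdrop n).
Proof.
case: n => [|n] p q eq_pq; first by apply/permP => -[].
have last_drop c : drop_pos c.+1 (@ord_max n) = ord0.
  by apply: val_inj; rewrite /= val_drop_pos /= subnn; case: ifPn => //; lia.
have eq_pq1 : entry p 1 = entry q 1.
  rewrite (entryE p ord0) (entryE q ord0).
  move/permP/(_ ord_max): eq_pq; rewrite !topdropE.
  by rewrite (entryE p ord0) (entryE q ord0) !last_drop => ->.
by move: eq_pq; rewrite /topdrop eq_pq1 => /mulgI.
Qed.

(* T^k for an integer k; [Negz m] is the integer -(m + 1). *)
Definition topdrop_pow (n : nat) (k : int) (p : 'S_n) : 'S_n :=
  match k with
  | Posz m => iter m (@topdrop n) p
  | Negz m => iter m.+1 (invF (@topdrop_inj n)) p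
  end.

(* Main.v *)
Require Import Defs.
From mathcomp Require Import all_boot all_order all_algebra all_fingroup.
From mathcomp Require Import zify.

Set Implicit Arguments.
Unset Strict Implicit.
Unset Printing Implicit Defensive.

(** Let R reverse the whole word and let A reverse everything after the first
    pi_1 entries. Both are involutions and T = R A, so A conjugates T to its
    inverse. If pi_1 is n or n - 1 then A fixes pi, hence
    T^k pi = A (T^(-k) pi), which is (1). Moreover T^2 = R A R A, so
    T^(-k+2) pi = R A R A (T^(-k) pi) = R A R (T^k pi), and R A R reverses the
    first n - pi_n entries, which is (2). *)

(** Positions are 0-based, so the tail is [c], ..., [n - 1] and its reflection keeps the sum
    [n + c - 1]. The value is always below [n], so the default of [insubd] never occurs. *)
Definition tail_pos (n c : nat) (i : 'I_n) : 'I_n :=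
  insubd i (if c <= i then n + c - i.+1 else i).

Lemma val_tail_pos n c (i : 'I_n) :
  tail_pos c i = (if c <= i then n + c - i.+1 else i) :> nat.
Proof.
rewrite /tail_pos val_insubd; case: ifP => //.
by have := ltn_ord i; case: ifP; lia.
Qed.

Lemma tail_posK n c : involutive (@tail_pos n c).
Proof.
move=> i; apply: val_inj; rewrite /= !val_tail_pos.
by have := ltn_ord i; do !case: ifP; lia.
Qed.

Definition rev_perm (n : nat) (p : 'S_n) : 'S_n := (perm (@rev_ord_inj n) * p)%g.

Definition rev_tail (n : nat) (p : 'S_n) : 'S_n :=
  (perm (inv_inj (@tail_posK n (entry p 1))) * p)%g.

Lemma rev_permE n (p : 'S_n) i : rev_perm p i = p (rev_ord i).
Proof. by rewrite permM permE. Qed.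

Lemma rev_tailE n (p : 'S_n) i : rev_tail p i = p (tail_pos (entry p 1) i).
Proof. by rewrite permM permE. Qed.

Lemma rev_permK n : involutive (@rev_perm n).
Proof. by move=> p; apply/permP => i; rewrite !rev_permE rev_ordK. Qed.

Lemma entry_le n (p : 'S_n) i : entry p i <= n.
Proof.
rewrite /entry; case: (ltnP i.-1 n) => [lt_in|le_ni].
  by have := entryE p (Ordinal lt_in); rewrite /entry /= => ->.
by rewrite nth_default // size_oneline.
Qed.

Lemma entry_rev_perm n (p : 'S_n) i :
  1 <= i <= n -> entry (rev_perm p) i = entry p (n.+1 - i).
Proof.
case: i => // i /= lt_in.
rewrite (entryE _ (Ordinal lt_in)) rev_permE -entryE /=.
by congr entry; lia.
Qed.

Lemma entry_rev_tail n (p : 'S_n) i : 1 <= i <= n ->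
  entry (rev_tail p) i =
    if i <= entry p 1 then entry p i else entry p (n + entry p 1 + 1 - i).
Proof.
case: i => // i /= lt_in.
rewrite (entryE _ (Ordinal lt_in)) rev_tailE -entryE val_tail_pos /=.
by case: ltnP => // ?; congr entry; lia.
Qed.

(** A first entry is at least 1, so the first position lies outside the reversed tail. The cut thus
    survives, which makes [rev_tail] an involution although its cut depends on the permutation. *)
Lemma entry_rev_tail1 n (p : 'S_n) : entry (rev_tail p) 1 = entry p 1.
Proof.
case: n p => [|n] p; first by rewrite /entry !nth_default ?size_oneline.
by rewrite entry_rev_tail // {1}(entryE p ord0).
Qed.

Lemma rev_tailK n : involutive (@rev_tail n).
Proof.
by move=> p; apply/permP => i; rewrite !rev_tailE entry_rev_tail1 tail_posK.
Qed.

(** The tail has at most one entry. *)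
Lemma rev_tail_id n (p : 'S_n) : n - 1 <= entry p 1 -> rev_tail p = p.
Proof.
move=> le_np; apply/permP => i; rewrite rev_tailE; congr (p _).
apply: val_inj; rewrite /= val_tail_pos.
by have := ltn_ord i; have := entry_le p 1; case: ifP; lia.
Qed.

(** The tail is reversed twice, so it comes to the front in its original order; the initial block is
    reversed once and ends up last. *)
Lemma topdrop_rev n (p : 'S_n) : topdrop p = rev_perm (rev_tail p).
Proof.
apply/permP => i; rewrite topdropE rev_permE rev_tailE; congr (p _).
apply: val_inj; rewrite /= val_drop_pos val_tail_pos /=.
by have := ltn_ord i; have := entry_le p 1; do !case: ifP; lia.
Qed.

Lemma invF_topdrop n (p : 'S_n) :
  invF (@topdrop_inj n) p = rev_tail (rev_perm p).
Proof.
by apply: (@topdrop_inj n); rewrite f_invF topdrop_rev rev_tailK rev_permK.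
Qed.

Lemma topdrop_powS n (k : int) (p : 'S_n) :
  topdrop_pow (k + 1)%R p = topdrop (topdrop_pow k p).
Proof.
(* The exponent -1 stands apart, since its successor crosses from [Negz] to [Posz]. *)
case: k => [m|[|m]].
- by rewrite (_ : _ + _ = Posz m.+1)%R //; lia.
- by rewrite /= f_invF.
by rewrite (_ : _ + _ = Negz m)%R /= ?f_invF //; lia.
Qed.

Lemma iter_intertwine (X Y : Type) (a : X -> Y) f g m :
  (forall x, a (f x) = g (a x)) -> forall x, a (iter m f x) = iter m g (a x).
Proof. by move=> afg x; elim: m => //= m <-. Qed.

(** With T = R A and its inverse A R, both A T and the inverse of T followed by A reduce to
    involution identities, so A passes through each iterate and inverts it. *)
Lemma rev_tail_topdrop_pow n (k : int) (p : 'S_n) :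
  rev_tail (topdrop_pow k p) = topdrop_pow (- k)%R (rev_tail p).
Proof.
have TtoV q : rev_tail (topdrop q) = invF (@topdrop_inj n) (rev_tail q).
  by rewrite topdrop_rev invF_topdrop.
have VtoT q : rev_tail (invF (@topdrop_inj n) q) = topdrop (rev_tail q).
  by rewrite topdrop_rev invF_topdrop !rev_tailK.
case: k => [[|m]|m] //; first exact: (iter_intertwine m.+1 TtoV).
exact: (iter_intertwine m.+1 VtoT).
Qed.

Theorem theorem3p9 (n : nat) (hn : 2 <= n) (p : 'S_n)
    (hp : entry p 1 = n \/ entry p 1 = n - 1) (k : int) :
  let p' := topdrop_pow k p in
  let p'' := topdrop_pow (- k)%R p in
  let p''' := topdrop_pow (- k + 2)%R p in
  ((forall i : nat, 1 <= i <= entry p' 1 -> entry p' i = entry p'' i) /\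
   (forall i : nat, entry p' 1 + 1 <= i <= n ->
      entry p' i = entry p'' (n + entry p' 1 + 1 - i))) /\
  ((forall i : nat, 1 <= i <= n - entry p' n ->
      entry p' i = entry p''' (n - entry p' n + 1 - i)) /\
   (forall i : nat, n - entry p' n + 1 <= i <= n ->
      entry p' i = entry p''' i)).
Proof.
move=> p' p'' p'''.
have p''E : p'' = rev_tail p'.
  by rewrite rev_tail_topdrop_pow rev_tail_id //; case: hp => ->; lia.
have p'''E : p''' = rev_perm (rev_tail (rev_perm p')).
  rewrite /p''' (_ : _ + 2 = - k + 1 + 1)%R; last by lia.
  by rewrite !topdrop_powS -/p'' !topdrop_rev p''E rev_tailK.
(* After the full reversal, the cut used by [rev_tail] is the last entry of [p']. *)
have rev1 : entry (rev_perm p') 1 = entry p' n.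
  by rewrite entry_rev_perm ?subn1 //; lia.
have le1 := entry_le p' 1; have len := entry_le p' n.
split; split=> i ltei.
- by rewrite p''E entry_rev_tail ?ifT //; lia.
- by rewrite p''E entry_rev_tail ?ifF; [congr entry | |]; lia.
(* With c the last entry of [p'], the index goes to c + i, beyond the cut, then to n + 1 - i, then
   to i. *)
- rewrite p'''E entry_rev_perm ?entry_rev_tail ?rev1; try lia.
  by rewrite ifF ?entry_rev_perm; [congr entry | |]; lia.
(* Here n + 1 - i is within the cut, so the two full reversals cancel. *)
rewrite p'''E entry_rev_perm ?entry_rev_tail ?rev1; try lia.
by rewrite ifT ?entry_rev_perm; [congr entry | |]; lia.
Qed.
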